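(* Let $N=1$, let $\alpha>0$ be a constant and $T>0$. Let $f$ be a non-negative, bounded and measurable function on $\mathbb{R}\times(0,T)$. Let $D_0=(s_{0-},s_{0+})$ with $-\infty<s_{0-}<s_{0+}<\infty$ and let $u_0\equiv0$. Then there exists no solution $(u,S(t))$ on $(0,T)$ (in the sense defined in the context) to the free boundary problem $$\partial_t u-\Delta u=f \ \text{ in } Q_T,\qquad u=0 \ \text{ on } S_T,\qquad \partial u/\partial\nu=-\alpha \ \text{ on } S_T,$$ with initial data $u|_{t=0}=u_0$, $S(t)|_{t=0}=S_0=\partial D_0$.
   Context: Notation. $D(t)\subset\mathbb{R}^N$ $(0<t<T)$ are domains with boundary $S(t)=\partial D(t)$; $Q_T=\bigcup_{0<t<T}D(t)\times\{t\}$, $S_T=\bigcup_{0<t<T}S(t)\times\{t\}$; $\partial/\partial\nu$ is the exterior normal derivative of $D(t)$ on $S(t)$. Both $u$ and the free boundary $S(t)$ are unknown. Solution of the equations. A solution is a classical non-negative solution: $u=u(x,t)\ge0$ is $C^2$ in $x$ and $C^1$ in $t$ in $Q_T$, with $\nabla^2u,\partial_tu\in C(Q_T)$ and $u,\nabla u\in C(Q_T\cup S_T)$, satisfying the equation in $Q_T$ and the boundary conditions on $S_T$; moreover $S_T$ is uniformly $C^{2,1}$ ($C^2$ in space, $C^1$ in time) in $\mathbb{R}^N\times(\varepsilon,T)$ for every $\varepsilon>0$. Solution of the initial value problem. In addition, $u$ is bounded and is continuous up to $t=0$ on $\overline{D_0}$ with value $u_0$ there (i.e. $u$ extended by $u_0$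 on $\overline{D_0}\times\{0\}$ is continuous), and $S(t)\to S_0$ as $t\downarrow0$ in the uniform $C^2$ topology. No control of the time derivative of $S(t)$ up to $t=0$ is assumed. In the present one-dimensional situation with $D_0=(s_{0-},s_{0+})$, this means $D(t)=(s_-(t),s_+(t))$ with $s_-<s_+$, $s_\pm\in C([0,T))\cap C^1((0,T))$, $s_\pm(0)=s_{0\pm}$ and $\dot s_\pm$ bounded on $(\varepsilon,T)$ for every $\varepsilon>0$; the boundary conditions read $u(s_\pm(t),t)=0$, $\partial_xu(s_-(t),t)=\alpha$ and $\partial_xu(s_+(t),t)=-\alpha$ for $0<t<T$. *)

(* Defs.v *)
From HB Require Import structures.
From mathcomp Require Import all_boot all_order all_algebra.
From mathcomp Require Import all_classical all_reals all_analysis.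
From mathcomp Require Import measurable_realfun.

Set Implicit Arguments.
Unset Strict Implicit.
Unset Printing Implicit Defensive.

Import Order.TTheory GRing.Theory Num.Theory.
Import numFieldNormedType.Exports.

Local Open Scope classical_set_scope.
Local Open Scope ring_scope.

(* Points of R x R are pairs z = (x, t): z.1 is space and z.2 is time.        *)

(* Lebesgue (not merely Borel) measurability on the plane:                    *)
(* completed_algebra_gen mu consists of the unions of a measurable set and    *)
(* of a mu-negligible set.                                                    *)
Definition lebesgue_measurable_fun (R : realType) (D : set (R * R))
    (f : R * R -> R) : Prop :=
  forall B : set R, measurable B ->
    completed_algebra_gen (@lebesgue_measure R \x @lebesgue_measure R)%E
      (D `&` f @^-1` B).

Section free_boundary_problem.
Context {R : realType}.
Implicit Types (sm sp : R -> R) (u v f : R * R -> R) (z : R * R) (T : R).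

Definition d_x v z : R := derive1 (fun y => v (y, z.2)) z.1.
Definition d_t v z : R := derive1 (fun s => v (z.1, s)) z.2.

Definition derivable_x v z : Prop := derivable (fun y => v (y, z.2)) z.1 1.
Definition derivable_t v z : Prop := derivable (fun s => v (z.1, s)) z.2 1.

Definition domain_QT T sm sp : set (R * R) :=
  [set z | 0 < z.2 < T /\ sm z.2 < z.1 < sp z.2].

Definition boundary_ST T sm sp : set (R * R) :=
  [set z | 0 < z.2 < T /\ (z.1 = sm z.2 \/ z.1 = sp z.2)].

(* The derivative may be unbounded as t tends to 0. *)
Definition regular_curve T (s : R -> R) : Prop :=
  [/\ forall t, 0 < t < T -> derivable s t 1,
      {within `]0, T[, continuous (derive1 s)}
    & forall e : R, 0 < e -> [bounded derive1 s t | t in `]e, T[] ].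

Record fb_solution (alpha T : R) f sm sp u : Prop := FBSolution {
  fb_curves_lt : forall t, 0 < t < T -> sm t < sp t ;
  fb_curve_m : regular_curve T sm ;
  fb_curve_p : regular_curve T sp ;
  fb_ge0 : forall z, domain_QT T sm sp z -> 0 <= u z ;
  fb_C2x : forall z, domain_QT T sm sp z ->
    derivable_x u z /\ derivable_x (d_x u) z ;
  fb_C1t : forall z, domain_QT T sm sp z -> derivable_t u z ;
  fb_cont_dxx : {within domain_QT T sm sp, continuous (d_x (d_x u))} ;
  fb_cont_dt : {within domain_QT T sm sp, continuous (d_t u)} ;
  fb_cont : {within domain_QT T sm sp `|` boundary_ST T sm sp, continuous u} ;
  fb_eqn : forall z, domain_QT T sm sp z -> d_t u z - d_x (d_x u) z = f z ;
  fb_dirichlet : forall z, boundary_ST T sm sp z -> u z = 0 ;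
  (* p is the gradient continuously extended to the free boundary; the values *)
  (* of u outside the closure of D(t) are irrelevant, so d_x u itself has no  *)
  (* meaning there. The exterior normal is -1 at sm t and +1 at sp t.         *)
  fb_neumann : exists p : R * R -> R,
    [/\ forall z, domain_QT T sm sp z -> p z = d_x u z,
        {within domain_QT T sm sp `|` boundary_ST T sm sp, continuous p},
        forall t, 0 < t < T -> p (sm t, t) = alpha
      & forall t, 0 < t < T -> p (sp t, t) = - alpha ]
}.

(* The values of u on the closure of D_0 x {0} are those of its extension by  *)
(* u0.                                                                        *)
Record fb_ivp_solution (alpha T : R) f (s0m s0p : R) (u0 : R -> R)
    sm sp u : Prop := FBIvpSolution {
  fb_ivp_sol : fb_solution alpha T f sm sp u ;
  fb_ivp_bounded : [bounded u z | z in domain_QT T sm sp] ;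
  fb_ivp_u0 : forall x, s0m <= x <= s0p -> u (x, 0) = u0 x ;
  fb_ivp_cont : {within domain_QT T sm sp `|` boundary_ST T sm sp
      `|` (`[s0m, s0p] `*` [set 0]), continuous u} ;
  fb_ivp_sm0 : sm 0 = s0m ;
  fb_ivp_sp0 : sp 0 = s0p ;
  fb_ivp_sm_cont : {within `[0, T[, continuous sm} ;
  fb_ivp_sp_cont : {within `[0, T[, continuous sp}
}.

End free_boundary_problem.

(* Main.v *)
Require Import Defs.
From HB Require Import structures.
From mathcomp Require Import all_boot all_order all_algebra.
From mathcomp Require Import all_classical all_reals all_analysis.
From mathcomp Require Import measurable_realfun ring lra.

Set Implicit Arguments.
Unset Strict Implicit.
Unset Printing Implicit Defensive.

Import Order.TTheory GRing.Theory Num.Theory.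
Import numFieldNormedType.Exports.

Local Open Scope classical_set_scope.
Local Open Scope ring_scope.

(** The source is bounded, so a solution starting from zero can only grow
linearly in time: [u <= G t] with [G > sup f] ([u_le_linear]). The boundary
condition at [sp t], on the other hand, forces [u] to grow with the fixed slope
[alpha] away from the boundary. A barrier of slope [b = alpha / 2] shows that
this is too much.

Take a line [x = M - v t] that lies to the right of the curve [sp] up to
time [tau] and touches it at some time [t1 > 0]. Such a line exists for all
small [tau] as soon as the total displacement [eta = v tau] is a fixed positive
number, because [sp] is continuous at time [0] ([touching_line]). With [y = M - v t - x] the function
[w = b y - K y^2 / 2], [K = G + v b], is a supersolution on [0 <= y <= b / K],
vanishes on the line and equals [b^2 / (2 K)] at the inner edge [y = b / K].
Since [K] is about [eta b / tau] for small [tau], this value is about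
[b tau / (2 eta)]: it is linear in [tau], just as the bound [G tau] on [u], and
it dominates that bound once [eta] is small with respect to [b / G]. The
parabolic comparison principle ([parabolic_comparison]) then yields
[u <= w <= b y] ([u_le_barrier]). At the touching point both [u] and [y]
vanish, and [u <= b y] with [b < alpha] contradicts the slope [alpha] of [u]
there ([u_ge_slope]). *)

(** * Derivative tests in one variable *)

Lemma is_derive_slope (R : realType) (g : R -> R) (x d e : R) :
  is_derive x 1 g d -> 0 < e ->
  exists2 r, 0 < r & forall y, y != x -> `|y - x| < r ->
    `|(g y - g x) / (y - x) - d| < e.
Proof.
move=> [dg <-] e_gt0.
have /cvgr_dist_lt/(_ _ e_gt0) [r /= r_gt0 rP] := dg.
exists r => // y yx yxr.
have := rP (y - x).
rewrite /ball_ /= sub0r normrN => /(_ yxr); rewrite subr_eq0 => /(_ yx).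
by rewrite /GRing.scale /= mulr1 subrK distrC mulrC.
Qed.

(** The maximum of a subsolution may occur at the final time, where only
earlier times are available; hence a one-sided test. *)
Lemma ge0_derive_left_max (R : realType) (g : R -> R) (t d a : R) :
  is_derive t 1 g d -> a < t -> (forall s, a < s < t -> g s <= g t) -> 0 <= d.
Proof.
move=> dg a_lt gmax; rewrite leNgt; apply/negP => d_lt0.
have Nd_gt0 : 0 < - d by rewrite oppr_gt0.
have [r r_gt0 rP] := is_derive_slope dg Nd_gt0.
have m_gt0 : 0 < Num.min (t - a) r by rewrite lt_min subr_gt0 a_lt.
have mta : Num.min (t - a) r <= t - a by rewrite ge_min lexx.
have mr : Num.min (t - a) r <= r by rewrite ge_min lexx orbT.
set m := Num.min _ _ in m_gt0 mta mr.
have st : t - m / 2 != t by apply/eqP; lra.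
have stE : t - m / 2 - t = - (m / 2) by rewrite addrC addKr.
have := rP _ st; rewrite stE normrN gtr0_norm; last lra.
have sr : m / 2 < r by lra.
move=> /(_ sr); rewrite ltr_norml => /andP[_].
rewrite invrN mulrN -mulNr opprB => slope_lt0.
have : 0 <= (g t - g (t - m / 2)) / (m / 2).
  by rewrite divr_ge0 ?subr_ge0 ?gmax //; lra.
lra.
Qed.

(** The slope of [g1] near its zero [x] has the sign of [g2]; were [g2]
positive, the mean value theorem would make [g] exceed [g x] just to the right
of [x]. The first derivative is an arbitrary function [g1] that has to be
correct only near [x], so that a difference of two derivatives can be supplied
without computing the derivative of a difference. *)
Lemma le0_derive2_max (R : realType) (g g1 : R -> R) (g2 x a b : R) :
  a < x < b -> (forall y, a < y < b -> is_derive y 1 g (g1 y)) ->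
  is_derive x 1 g1 g2 -> (forall y, a < y < b -> g y <= g x) -> g2 <= 0.
Proof.
move=> axb dg dg1 gmax; have /andP[ax xb] := axb.
rewrite leNgt; apply/negP => g2_gt0.
have g1x : g1 x = 0.
  have g'x0 : is_derive x 1 g 0.
    apply: (@derive1_at_max _ g a b).
    - lra.
    - by move=> y; rewrite in_itv /= => /dg [].
    - by rewrite in_itv.
    - by move=> y; rewrite in_itv /=; apply: gmax.
  by rewrite -(@derive_val _ _ _ _ _ _ _ (dg x axb)) derive_val.
have [r r_gt0 rP] := is_derive_slope dg1 g2_gt0.
have m_gt0 : 0 < Num.min (b - x) r by rewrite lt_min subr_gt0 xb.
have mbx : Num.min (b - x) r <= b - x by rewrite ge_min lexx.
have mr : Num.min (b - x) r <= r by rewrite ge_min lexx orbT.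
set m := Num.min _ _ in m_gt0 mbx mr.
have xy : x < x + m / 2 by lra.
have [|| c] := @MVT _ g g1 _ _ xy.
- by move=> y; rewrite in_itv /= => /andP[? ?]; apply: dg; apply/andP; split; lra.
- apply: derivable_within_continuous => y; rewrite in_itv /= => /andP[? ?].
  by have [] : is_derive y 1 g (g1 y); first by apply: dg; apply/andP; split; lra.
rewrite in_itv /= => /andP[xc cy] gE.
have : g (x + m / 2) <= g x by apply: gmax; apply/andP; split; lra.
apply/negP; rewrite -ltNge -subr_gt0 gE mulr_gt0 //; last lra.
have cx : c != x by apply/eqP; lra.
have cx_gt0 : 0 < c - x by lra.
have := rP _ cx; rewrite g1x subr0 gtr0_norm // => rc.
have /rc : c - x < r by lra.
rewrite ltr_norml => /andP[+ _]; rewrite -[X in X < _]sub0r ltrD2r.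
by rewrite pmulr_lgt0 // invr_gt0.
Qed.

(** * The comparison principle in a noncylindrical domain *)

Definition slab (R : realType) (tau : R) (l r : R -> R) : set (R * R) :=
  [set z | 0 <= z.2 <= tau /\ l z.2 <= z.1 <= r z.2].

Lemma compact_slab (R : realType) (tau : R) (l r : R -> R) :
  0 <= tau -> continuous l -> continuous r -> compact (slab tau l r).
Proof.
move=> tau_ge0 lc rc.
have [a _ aP] := EVT_min tau_ge0 (continuous_subspaceT lc).
have [b _ bP] := EVT_max tau_ge0 (continuous_subspaceT rc).
apply: (@subclosed_compact _ _ (`[l a, r b] `*` `[0, tau])).
- have -> : slab tau l r = [set z | 0 <= z.2] `&` [set z | z.2 <= tau] `&`
      ([set z | 0 <= z.1 - l z.2] `&` [set z | z.1 - r z.2 <= 0]).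
    apply/seteqP; split=> z.
      by move=> [/andP[? ?] /andP[? ?]]; do !split; rewrite /= ?subr_ge0 ?subr_le0.
    move=> [[z0 zt]] [] /=; rewrite subr_ge0 subr_le0 => lz rz.
    by split; apply/andP.
  have cl (k : R * R -> R) (D : set R) : continuous k -> closed D ->
      closed (k @^-1` D) by move=> kc; apply: preimage_closed => z _; exact: kc.
  have c2 : continuous (@snd R R) by move=> z; exact: cvg_snd.
  have c1 : continuous (@fst R R) by move=> z; exact: cvg_fst.
  apply: closedI; apply: closedI.
  + by apply: (cl _ [set x | 0 <= x]) => //; exact: closed_ge.
  + by apply: (cl _ [set x | x <= tau]) => //; exact: closed_le.
  + apply: (cl (fun z => z.1 - l z.2) [set x | 0 <= x]); last exact: closed_ge.
    move=> z; apply: cvgB; first exact: c1.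
    by apply: continuous_comp; [exact: c2 | exact: lc].
  + apply: (cl (fun z => z.1 - r z.2) [set x | x <= 0]); last exact: closed_le.
    move=> z; apply: cvgB; first exact: c1.
    by apply: continuous_comp; [exact: c2 | exact: rc].
- by apply: compact_setX; exact: segment_compact.
- move=> [x t] [/= t01 /andP[lx xr]].
  have tI : t \in `[0, tau] by rewrite in_itv.
  by rewrite !in_itv /= t01 (le_trans (aP t tI) lx) (le_trans xr (bP t tI)).
Qed.

(** At a positive maximum of [u - w] off the parabolic boundary one has
[d_t (u - w) >= 0] and [d_x (d_x (u - w)) <= 0], which the strict inequality
between the two heat operators excludes. The curves [l] and [r] may cross:
the slab is then empty at the times in question. *)
Lemma parabolic_comparison (R : realType) (tau : R) (l r : R -> R)
    (u w wx wxx wt : R * R -> R) :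
  0 <= tau -> continuous l -> continuous r ->
  {within slab tau l r, continuous u} -> {within slab tau l r, continuous w} ->
  (forall z : R * R, is_derive z.1 1 (fun y => w (y, z.2)) (wx z)) ->
  (forall z : R * R, is_derive z.1 1 (fun y => wx (y, z.2)) (wxx z)) ->
  (forall z : R * R, is_derive z.2 1 (fun s => w (z.1, s)) (wt z)) ->
  (forall z : R * R, 0 < z.2 <= tau -> l z.2 < z.1 < r z.2 ->
    [/\ derivable_x u z, derivable_x (d_x u) z, derivable_t u z
      & d_t u z - d_x (d_x u) z < wt z - wxx z]) ->
  (forall z : R * R, slab tau l r z -> [\/ z.2 = 0, z.1 = l z.2 | z.1 = r z.2] ->
    u z <= w z) ->
  forall z, slab tau l r z -> u z <= w z.
Proof.
move=> tau_ge0 lc rc uc wc dwx dwxx dwt subsol bdry z0 Az0.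
have [] := @compact_EVT_max _ _ (fun z => u z - w z) (slab tau l r).
- by exists z0.
- exact: compact_slab.
- exact: within_continuousB.
move=> [x t]; rewrite inE => Axt /= maxP.
rewrite -subr_le0; apply: le_trans (maxP z0 _) _; first exact: mem_set.
rewrite subr_le0; have [/= /andP[t_ge0 t_le] /andP[lx xr]] := Axt.
have [t0|tn0] := eqVneq t 0; first by apply: bdry => //; constructor 1.
have [xl|xnl] := eqVneq x (l t); first by apply: bdry => //; constructor 2.
have [xr'|xnr] := eqVneq x (r t); first by apply: bdry => //; constructor 3.
have t_gt0 : 0 < t by rewrite lt_neqAle eq_sym tn0.
have lx' : l t < x by rewrite lt_neqAle eq_sym xnl.
have xr' : x < r t by rewrite lt_neqAle xnr.
have [||ux uxx ut] := subsol (x, t); rewrite /= ?t_gt0 ?lx' //.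
suff [? ?] : 0 <= d_t u (x, t) - wt (x, t) /\
    d_x (d_x u) (x, t) - wxx (x, t) <= 0 by lra.
have dE (g : R -> R) (y : R) : derivable g y 1 -> is_derive y 1 g (derive1 g y).
  by move=> dg; rewrite derive1E; exact: derivableP.
split.
(* By continuity of the curves, the same position at slightly earlier times
   is still in the slab. *)
- have [e /= e_gt0 eP] : \forall s \near t, l s < x /\ x < r s.
    by apply: filterI; [apply: (cvgr_lt _ (lc t)) | apply: (cvgr_gt _ (rc t))].
  have e_max : Num.max (t - e) 0 < t by rewrite gt_max ltrBlDr ltrDl e_gt0.
  apply: (ge0_derive_left_max
    (g := fun s => u (x, s) - w (x, s)) (t := t) (d := _ - _) _ e_max).
    by apply: is_deriveB; [exact: dE | exact: (dwt (x, t))].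
  move=> s /andP[]; rewrite gt_max => /andP[es s_gt0] st.
  apply: (maxP (x, s)); apply/mem_set; split=> /=; first by apply/andP; split; lra.
  have [] : l s < x /\ x < r s.
    by apply: eP; rewrite /= gtr0_norm; lra.
  by move=> ? ?; apply/andP; split; exact: ltW.
- apply: (@le0_derive2_max R (fun y => u (y, t) - w (y, t))
    (fun y => d_x u (y, t) - wx (y, t)) _ x (l t) (r t)).
  + by rewrite lx'.
  + move=> y lyr; apply: is_deriveB; last exact: (dwx (y, t)).
    have yt : 0 < (y, t).2 <= tau by rewrite /= t_gt0.
    have [uy _ _ _] := subsol (y, t) yt lyr.
    exact: (dE (fun y => u (y, t)) y uy).
  + apply: is_deriveB; last exact: (dwxx (x, t)).
    exact: (dE (fun y => d_x u (y, t)) x uxx).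
  + move=> y /andP[ly yr]; apply: (maxP (y, t)); apply/mem_set; split=> /=.
      by rewrite t_ge0.
    by rewrite !ltW.
Qed.

(** * Auxiliary continuity and derivative facts *)

Lemma within_continuous_comp_cont (X Y Z : topologicalType) (A : set X)
    (B : set Y) (f : X -> Y) (g : Y -> Z) :
  continuous f -> (forall x, A x -> B (f x)) -> {within B, continuous g} ->
  {within A, continuous (g \o f)}.
Proof.
move=> fc fAB /subspace_continuousP gc; apply/subspace_continuousP => x Ax.
move=> U /(gc _ (fAB _ Ax)); rewrite /within /nbhs /= => /(fc x).
by rewrite /nbhs /=; apply: filterS => y /= BU Ay; exact: BU (fAB _ Ay).
Qed.

(** The nearest point between [0] and [tau]. Composing with it turns a curve
that is continuous for [0 <= t < T] into a globally continuous one with the same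
values up to time [tau], as the compactness of slabs requires. *)
Definition clamp (R : realType) (tau t : R) : R := Num.max 0 (Num.min t tau).

Lemma clamp_id (R : realType) (tau t : R) : 0 <= t <= tau -> clamp tau t = t.
Proof. by move=> /andP[t0 tT]; rewrite /clamp (min_l tT) (max_r t0). Qed.

Lemma clamp_bounds (R : realType) (tau t : R) :
  0 <= tau -> 0 <= clamp tau t <= tau.
Proof. by move=> tau0; rewrite /clamp le_max lexx ge_max tau0 ge_min lexx orbT. Qed.

Lemma continuous_clamp (R : realType) (tau : R) : continuous (clamp tau).
Proof.
move=> t; apply: (@continuous_max _ _ (cst 0) (fun t => Num.min t tau)).
  exact: cst_continuous.
apply: (@continuous_min _ _ id (cst tau)); last exact: cst_continuous.
exact: cvg_id.
Qed.

Lemma continuous_clamped (R : realType) (tau T : R) (s : R -> R) :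
  0 <= tau < T -> {within `[0, T[, continuous s} ->
  continuous (s \o clamp tau).
Proof.
move=> /andP[tau0 tauT] sc; apply/continuous_subspace_setT.
apply: within_continuous_comp_cont sc; first exact: continuous_clamp.
move=> t _; have /andP[c0 ct] := clamp_bounds t tau0.
by rewrite /= in_itv /= c0 (le_lt_trans ct).
Qed.

Lemma is_derive_affine (R : realType) (m k x : R) :
  is_derive x 1 (fun s => m + k * s) k.
Proof.
apply: (is_derive_eq (is_deriveD (is_derive_cst m x 1)
  (is_deriveZ k (is_derive_id x (1:R))))).
by rewrite add0r /GRing.scale /= mulr1.
Qed.

Lemma is_derive_quadratic (R : realType) (b K m k x : R) :
  is_derive x 1 (fun s => b * (m + k * s) - K / 2 * (m + k * s) ^+ 2)
    (k * (b - K * (m + k * x))).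
Proof.
have dy := is_derive_affine m k x.
apply: (@is_derive_eq _ _ _ _ _ _ _ (b *: k -
    (K / 2) *: ((2%:R * (m + k * x) ^+ 1) *: k))).
  apply: is_deriveB; apply: is_deriveZ.
  exact: (is_deriveX 2 dy).
by rewrite /GRing.scale /= expr1; field.
Qed.

(** * A moving line that touches the free boundary *)

(** A line moving to the left with speed [eta / tau] gains [eta] by time [tau],
more than [s] can lose in so short a time; so [s t + eta / tau * t] is larger
at [tau] than at [0], and its maximum up to time [tau] is attained after time
[0]. *)
Lemma touching_line (R : realType) (T eta d : R) (s : R -> R) :
  0 < T -> 0 < eta -> 0 < d -> {within `[0, T[, continuous s} ->
  exists tau t1, [/\ 0 < tau < T, tau <= d, 0 < t1 <= tau
    & forall t, 0 <= t <= tau -> s t + eta / tau * t <= s t1 + eta / tau * t1].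
Proof.
move=> T_gt0 eta_gt0 d_gt0 sc.
(* Time scale on which [s] loses less than [eta]. *)
have [e /= e_gt0 eP] : \forall t \near (0 : R), `[0, T[%classic t -> s 0 - eta < s t.
  have /subspace_continuousP/(_ 0) := sc.
  rewrite /= in_itv /= lexx T_gt0 => /(_ isT) s0.
  by apply: (cvgr_gt _ s0); rewrite ltrBlDr ltrDl.
pose m := Num.min (Num.min e T) d; pose tau := m / 2.
have m_gt0 : 0 < m by rewrite !lt_min e_gt0 T_gt0.
have me : m <= e by rewrite !ge_min lexx.
have mT : m <= T by rewrite !ge_min lexx orbT.
have md : m <= d by rewrite !ge_min lexx !orbT.
have tau_gt0 : 0 < tau by rewrite divr_gt0.
have tauT : tau < T by rewrite /tau; lra.
have [|t1 + t1P] := @EVT_max R (fun t => (s \o clamp tau) t + eta / tau * t) 0 tau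
    (ltW tau_gt0).
  apply: continuous_subspaceT => t; apply: cvgD.
    by apply: (@continuous_clamped _ _ T) => //; rewrite ltW.
  by apply: cvgM; [exact: cvg_cst | exact: cvg_id].
rewrite in_itv /= => t1tau; have /andP[t1_ge0 t1_le] := t1tau.
have {}t1P t : 0 <= t <= tau -> s t + eta / tau * t <= s t1 + eta / tau * t1.
  by move=> tt; have := t1P t; rewrite in_itv /= !clamp_id // => ->.
exists tau, t1; split=> //.
- by rewrite tau_gt0.
- by rewrite /tau; lra.
- rewrite t1_le andbT lt_neqAle t1_ge0 andbT eq_sym; apply/eqP => t10.
  have := t1P tau; rewrite lexx ltW // t10 mulr0 addr0 divfK ?gt_eqF // => /(_ isT).
  apply/negP; rewrite -ltNge -ltrBlDr; apply: eP.
    by rewrite /= sub0r normrN gtr0_norm // /tau; lra.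
  by rewrite /= in_itv /= ltW.
Qed.

(** * Bounds on a solution that starts from zero *)

Definition closed_domain (R : realType) (T s0m s0p : R) (sm sp : R -> R) :
    set (R * R) :=
  domain_QT T sm sp `|` boundary_ST T sm sp `|` (`[s0m, s0p] `*` [set 0]).

Section InitialValueProblem.
Context (R : realType) (alpha T : R) (f : R * R -> R) (s0m s0p : R).
Context (sm sp : R -> R) (u : R * R -> R).
Context (sol : fb_ivp_solution alpha T f s0m s0p (fun=> 0) sm sp u).

Lemma closed_domainP (z : R * R) : 0 <= z.2 < T -> sm z.2 <= z.1 <= sp z.2 ->
  closed_domain T s0m s0p sm sp z.
Proof.
case: z => x t /= /andP[t_ge0 tT] /andP[mx xp].
have [t0|tn0] := eqVneq t 0.
  right; split=> //=; move: mx xp.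
  by rewrite t0 (fb_ivp_sm0 sol) (fb_ivp_sp0 sol) in_itv /= => -> ->.
have t_gt0 : 0 < t by rewrite lt_neqAle eq_sym tn0.
left; have [xm|xnm] := eqVneq x (sm t).
  by right; split; rewrite /= ?t_gt0 //; left.
have [xp'|xnp] := eqVneq x (sp t).
  by right; split; rewrite /= ?t_gt0 //; right.
left; split; first by rewrite /= t_gt0.
by rewrite /= !lt_neqAle eq_sym xnm mx xnp xp.
Qed.

Lemma u_initial (x : R) : sm 0 <= x <= sp 0 -> u (x, 0) = 0.
Proof.
by rewrite (fb_ivp_sm0 sol) (fb_ivp_sp0 sol) => /(fb_ivp_u0 sol).
Qed.

Lemma u_lateral (z : R * R) : 0 < z.2 < T ->
  z.1 = sm z.2 \/ z.1 = sp z.2 -> u z = 0.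
Proof. by move=> zT zS; apply: (fb_dirichlet (fb_ivp_sol sol)). Qed.

(** The comparison principle for a solution against a strict supersolution, in
the part of the domain to the right of a curve [l]; the freedom in [l] serves
both the whole domain and a boundary layer at [sp]. *)
Lemma le_supersolution (F tau : R) (l : R -> R) (w wx wxx wt : R * R -> R) :
  (forall z : R * R, 0 < z.2 < T -> f z <= F) ->
  0 <= tau < T -> continuous l ->
  (forall t, 0 <= t <= tau -> sm t <= l t) ->
  continuous w ->
  (forall z : R * R, is_derive z.1 1 (fun y => w (y, z.2)) (wx z)) ->
  (forall z : R * R, is_derive z.1 1 (fun y => wx (y, z.2)) (wxx z)) ->
  (forall z : R * R, is_derive z.2 1 (fun s => w (z.1, s)) (wt z)) ->
  (forall z : R * R, 0 < z.2 <= tau -> l z.2 < z.1 < sp z.2 ->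
    F < wt z - wxx z) ->
  (forall z : R * R, 0 <= z.2 <= tau -> l z.2 <= z.1 <= sp z.2 ->
    [\/ z.2 = 0, z.1 = l z.2 | z.1 = sp z.2] -> u z <= w z) ->
  forall z : R * R, 0 <= z.2 <= tau -> l z.2 <= z.1 <= sp z.2 -> u z <= w z.
Proof.
move=> fF tauT lc sml wc dwx dwxx dwt super bdry z zt zx.
have /andP[tau_ge0 tau_ltT] := tauT.
have spc := continuous_clamped tauT (fb_ivp_sp_cont sol).
have slabE z' : slab tau l (sp \o clamp tau) z' <->
    0 <= z'.2 <= tau /\ l z'.2 <= z'.1 <= sp z'.2.
  by rewrite /slab /=; split=> -[z't]; rewrite clamp_id.
apply: (parabolic_comparison (tau := tau) (l := l) (r := sp \o clamp tau) _ _ _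
  _ _ dwx dwxx dwt) => //.
- apply: continuous_subspaceW (fb_ivp_cont sol) => z' /slabE [z't].
  move=> /andP[lz' z'p]; apply: closed_domainP; last first.
    by rewrite (le_trans (sml _ z't) lz').
  by have /andP[-> /le_lt_trans ->] := z't.
- exact: continuous_subspaceT.
- move=> z' z't; have /andP[z'0 z'tau] := z't.
  rewrite /= clamp_id; last by rewrite ltW.
  move=> lz'; have /andP[lz'1 lz'2] := lz'.
  have Qz' : domain_QT T sm sp z'.
    split; first by rewrite z'0 (le_lt_trans z'tau).
    by rewrite lz'2 (le_lt_trans (sml _ _) lz'1) // ltW.
  have [ux uxx] := fb_C2x (fb_ivp_sol sol) Qz'.
  split; [exact: ux | exact: uxx | exact: (fb_C1t (fb_ivp_sol sol)) |].
  rewrite (fb_eqn (fb_ivp_sol sol) Qz').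
  by apply: le_lt_trans (super z' z't lz'); apply: fF; case: Qz'.
- move=> z' /slabE [z't z'x] H; apply: bdry => //.
  by move: H; rewrite /= clamp_id.
- by apply/slabE.
Qed.

(** Comparison with the function [(F + 1) t]; the added [1] makes it a strict
supersolution. *)
Lemma u_le_linear (F tau : R) : 0 <= F ->
  (forall z : R * R, 0 < z.2 < T -> f z <= F) -> 0 <= tau < T ->
  forall z : R * R, 0 <= z.2 <= tau -> sm z.2 <= z.1 <= sp z.2 ->
    u z <= (F + 1) * z.2.
Proof.
move=> F_ge0 fF tauT z zt zx.
have /andP[_ tau_ltT] := tauT.
apply: (@le_supersolution F tau (sm \o clamp tau) (fun z => (F + 1) * z.2)
  (fun=> 0) (fun=> 0) (fun=> F + 1)) => //.
- exact: continuous_clamped (fb_ivp_sm_cont sol).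
- by move=> t tt; rewrite /= clamp_id.
- by move=> z'; apply: cvgM; [exact: cvg_cst | exact: cvg_snd].
- by move=> z'; exact: (is_derive_cst ((F + 1) * z'.2)).
- by move=> z'; exact: (is_derive_cst (0 : R)).
- move=> z'.
  apply: (is_derive_eq (is_deriveZ (F + 1) (is_derive_id z'.2 (1 : R)))).
  by rewrite /GRing.scale /= mulr1.
- by move=> *; lra.
- move=> [x t] /= tt; rewrite clamp_id // => xt H.
  have /andP[t_ge0 ttau] := tt.
  suff -> : u (x, t) = 0 by rewrite mulr_ge0 // addr_ge0.
  have [t0|tn0] := eqVneq t 0.
    by rewrite t0; apply: u_initial; rewrite -t0.
  apply: u_lateral => /=.
    by rewrite lt_neqAle eq_sym tn0 t_ge0 (le_lt_trans ttau).
  by case: H => [t0|xl|xp]; [rewrite t0 eqxx in tn0 | left | right].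
- by rewrite /= clamp_id.
Qed.

(** Comparison with [w = b y - K y^2 / 2], where [y = M - v t - x] and
[K = F + 1 + v b]. Indeed [w_t - w_xx = K - v (b - K y) = F + 1 + v K y] exceeds
the source wherever [y >= 0]. On [0 <= y <= b / K] the barrier is nonnegative,
and at [y = b / K] it equals [b^2 / (2 K)], which the smallness hypothesis puts
above the bound [(F + 1) tau] on [u]. *)
Lemma u_le_barrier (F tau v b M : R) : 0 <= F ->
  (forall z : R * R, 0 < z.2 < T -> f z <= F) ->
  0 < tau < T -> 0 <= v -> 0 < b ->
  (forall t, 0 <= t <= tau -> sp t + v * t <= M) ->
  2 * ((F + 1) * tau) * (F + 1 + v * b) <= b ^+ 2 ->
  forall z : R * R, 0 <= z.2 <= tau ->
    M - v * z.2 - b / (F + 1 + v * b) <= z.1 -> sm z.2 <= z.1 <= sp z.2 ->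
    u z <= b * (M - v * z.2 - z.1).
Proof.
move=> F_ge0 fF /andP[tau_gt0 tauT] v_ge0 b_gt0 spM small.
have tau_ge0 := ltW tau_gt0.
have tauT' : 0 <= tau < T by rewrite tau_ge0.
set K := F + 1 + v * b in small *.
have vb_ge0 : 0 <= v * b by rewrite mulr_ge0 // ltW.
have K_gt0 : 0 < K by rewrite /K; lra.
have bK_gt0 : 0 < b / K by rewrite divr_gt0.
have bKE : K * (b / K) = b by rewrite mulrC divfK // gt_eqF.
(* Left edge of the region of comparison: the line [y = b / K], cut off by the
   left free boundary. *)
pose l t := Num.max ((sm \o clamp tau) t) (M - v * t - b / K).
pose w (z : R * R) := b * (M - v * z.2 - z.1) - K / 2 * (M - v * z.2 - z.1) ^+ 2.
have wE (z : R * R) : w z = b * (M - v * z.2 - z.1) -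
    K / 2 * (M - v * z.2 - z.1) ^+ 2 by [].
suff main : forall z : R * R, 0 <= z.2 <= tau -> l z.2 <= z.1 <= sp z.2 -> u z <= w z.
  move=> z zt lz /andP[mz zp]; apply: le_trans (main z zt _) _.
    by rewrite /l ge_max /= clamp_id // mz lz.
  rewrite wE gerBl mulr_ge0 ?sqr_ge0 //; lra.
have yP (z : R * R) : 0 <= z.2 <= tau -> l z.2 <= z.1 <= sp z.2 ->
    [/\ sm z.2 <= z.1, M - v * z.2 - b / K <= z.1, z.1 <= sp z.2
      & z.1 <= M - v * z.2].
  move=> zt; rewrite /l ge_max /= clamp_id // => /andP[/andP[? ?] zp].
  by split=> //; have := spM _ zt; lra.
apply: (@le_supersolution F tau l w
  (fun z => - b + K * (M - v * z.2 - z.1)) (fun=> - K)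
  (fun z => - v * (b - K * (M - v * z.2 - z.1)))).
- exact: fF.
- exact: tauT'.
- move=> t; apply: (@continuous_max R R (sm \o clamp tau)
    (fun t => M - v * t - b / K)).
    exact: (continuous_clamped tauT' (fb_ivp_sm_cont sol)).
  apply: cvgB; last exact: cvg_cst.
  apply: cvgB; first exact: cvg_cst.
  by apply: cvgM; [exact: cvg_cst | exact: cvg_id].
- by move=> t tt; rewrite /l le_max /= clamp_id // lexx.
- have yc : continuous (fun z : R * R => M - v * z.2 - z.1).
    move=> z; apply: cvgB; last exact: cvg_fst.
    apply: cvgB; first exact: cvg_cst.
    by apply: cvgM; [exact: cvg_cst | exact: cvg_snd].
  move=> z; apply: cvgB; apply: cvgM; try exact: cvg_cst.
    exact: yc.
  by rewrite expr2; apply: cvgM; exact: yc.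
- move=> z; have := is_derive_quadratic b K (M - v * z.2) (- 1) z.1.
  have -> : (fun s => b * (M - v * z.2 + -1 * s) -
      K / 2 * (M - v * z.2 + -1 * s) ^+ 2) = (fun y => w (y, z.2)).
    by apply/funext => y; rewrite wE /=; ring.
  by move=> /is_derive_eq; apply; ring.
- move=> z; have := is_derive_affine (- b + K * (M - v * z.2)) (- K) z.1.
  congr (is_derive _ _ _ _).
  by apply/funext => y /=; ring.
- move=> z; have := is_derive_quadratic b K (M - z.1) (- v) z.2.
  have -> : (fun s => b * (M - z.1 + - v * s) -
      K / 2 * (M - z.1 + - v * s) ^+ 2) = (fun s => w (z.1, s)).
    by apply/funext => y; rewrite wE /=; ring.
  by move=> /is_derive_eq; apply; ring.
- move=> z /andP[z0 zt] /andP[lz zp].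
  have [||_ _ _ yz] := yP z; rewrite ?zt ?ltW //.
  have : 0 <= v * (K * (M - v * z.2 - z.1)).
    by rewrite mulr_ge0 // mulr_ge0 ?subr_ge0 // ltW.
  by rewrite /K; lra.
- move=> [x t] /= tt lx H; have /andP[t_ge0 ttau] := tt.
  have [/= mx lx' xp yx] := yP (x, t) tt lx.
  have [y_ge0 y_le] : 0 <= M - v * t - x /\ M - v * t - x <= b / K by split; lra.
  have w_ge0 : 0 <= w (x, t).
    rewrite wE /=; set y := _ - x in y_ge0 y_le *.
    have -> : b * y - K / 2 * y ^+ 2 = y * (b - K * y / 2) by field.
    rewrite mulr_ge0 //.
    have : K * y <= b by rewrite -bKE ler_wpM2l // ltW.
    lra.
  have mxp : sm t <= x <= sp t by rewrite mx.
  have [t0|tn0] := eqVneq t 0.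
    by move: mxp w_ge0; rewrite t0 => /u_initial ->.
  have t_gt0 : 0 < t by rewrite lt_neqAle eq_sym tn0.
  have lat : x = sm t \/ x = sp t -> u (x, t) <= w (x, t).
    by move=> xS; rewrite u_lateral //= t_gt0 (le_lt_trans ttau).
  case: H => [t0|xl|xpE]; [by rewrite t0 eqxx in tn0 | | by apply: lat; right].
  have [xsm|xnsm] := eqVneq x (sm t); first by apply: lat; left.
  have xE : M - v * t - x = b / K.
    move: xl; rewrite /l /= clamp_id //; case: (leP (sm t)) => _ xE.
      by rewrite xE; lra.
    by rewrite xE eqxx in xnsm.
  apply: le_trans (u_le_linear F_ge0 fF tauT' (z := (x, t)) tt mxp) _ => /=.
  rewrite wE /= xE.
  have -> : b * (b / K) - K / 2 * (b / K) ^+ 2 = b ^+ 2 / (2 * K).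
    by field; rewrite gt_eqF.
  rewrite ler_pdivlMr ?mulr_gt0 //.
  apply: le_trans small.
  have : (F + 1) * t <= (F + 1) * tau by rewrite ler_wpM2l //; lra.
  move=> /(ler_wpM2r (ltW K_gt0)); lra.
Qed.

(** By the mean value theorem, the difference quotients of [u] at the free
boundary are values of the gradient at interior points, and these converge to
[- alpha]. *)
Lemma u_ge_slope (c t : R) : 0 < t < T -> c < alpha ->
  exists2 x0, x0 < sp t &
    forall x, x0 < x < sp t -> sm t < x /\ c * (sp t - x) < u (x, t).
Proof.
move=> tT ca; have /andP[t_gt0 t_lt] := tT.
have S := fb_ivp_sol sol.
have [p [pE pc _ pp]] := fb_neumann S.
have mp := fb_curves_lt S tT.
have xc : continuous (fun x : R => (x, t)).
  by move=> x; apply: (cvg_pair (G := nbhs x) (H := nbhs t));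
    [exact: cvg_id | exact: cvg_cst].
have inQS x : `]sm t, sp t]%classic x ->
    (domain_QT T sm sp `|` boundary_ST T sm sp) (x, t).
  rewrite /= in_itv /= => /andP[mx xp].
  have [xE|xn] := eqVneq x (sp t); first by right; split; [|right].
  by left; split; rewrite //= mx lt_neqAle xn xp.
have uc := within_continuous_comp_cont xc inQS (fb_cont S).
have {}pc := within_continuous_comp_cont xc inQS pc.
have spI : `]sm t, sp t]%classic (sp t) by rewrite /= in_itv /= mp lexx.
have [e /= e_gt0 eP] : \forall x \near sp t, `]sm t, sp t]%classic x ->
    p (x, t) < - c.
  have /subspace_continuousP/(_ _ spI) ps := pc.
  have spc : p (sp t, t) < - c by rewrite pp // ltrN2.
  by apply: (cvgr_lt _ ps); exact: spc.
exists (Num.max (sm t) (sp t - e)).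
  by rewrite gt_max mp ltrBlDr ltrDl.
move=> x; rewrite gt_max => /andP[/andP[mx ex] xp]; split=> //.
have ux y : x < y < sp t -> is_derive y 1 (fun y => u (y, t)) (p (y, t)).
  move=> /andP[xy yp].
  have Qy : domain_QT T sm sp (y, t) by split=> //=; rewrite yp (lt_trans mx).
  have [uy _] := fb_C2x S Qy.
  by rewrite pE // /d_x /= derive1E; exact: derivableP.
have [|y] := MVT xp ux.
  apply: continuous_subspaceW uc => y /=; rewrite !in_itv /= => /andP[xy ->].
  by rewrite (lt_le_trans mx).
rewrite in_itv /= => /andP[xy yp].
rewrite u_lateral //=; last by right.
rewrite sub0r => uE.
have py : p (y, t) < - c.
  apply: eP; first by rewrite /= gtr0_norm; lra.
  by rewrite /= in_itv /= (lt_trans mx) // ltW.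
rewrite -[u (x, t)]opprK uE -mulNr ltr_pM2r ?subr_gt0 //; lra.
Qed.

End InitialValueProblem.

(** * Nonexistence *)

Theorem corollary1p2 (R : realType) (alpha T : R) (f : R * R -> R)
    (s0m s0p : R)
    (alpha_gt0 : 0 < alpha) (T_gt0 : 0 < T)
    (f_ge0 : forall z : R * R, 0 < z.2 < T -> 0 <= f z)
    (f_bounded : [bounded f z | z in [set: R] `*` `]0, T[])
    (f_measurable : lebesgue_measurable_fun ([set: R] `*` `]0, T[) f)
    (s0_lt : s0m < s0p) :
  ~ exists (sm sp : R -> R) (u : R * R -> R),
      fb_ivp_solution alpha T f s0m s0p (fun=> 0) sm sp u.
Proof.
move=> [sm [sp [u sol]]].
have [F F_gt0 FP] := ex_strict_bound_gt0 f_bounded.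
have fF (z : R * R) : 0 < z.2 < T -> f z <= F.
  move=> zT; apply: le_trans (ler_norm _) (ltW _); apply: FP.
  by split; rewrite //= in_itv.
pose G := F + 1; pose b := alpha / 2.
have G_gt0 : 0 < G by rewrite /G; lra.
have b_gt0 : 0 < b by rewrite /b; lra.
(* With [K = G + v b], [v = eta / tau], the smallness condition
   [2 G tau K <= b^2] of the barrier becomes
   [2 G^2 tau + 2 G eta b <= b^2]; the choices below make each of the two terms
   at most [b^2 / 4]. *)
pose eta := b / (8 * G); pose d := b ^+ 2 / (8 * G ^+ 2).
have eta_gt0 : 0 < eta by rewrite divr_gt0 // mulr_gt0.
have d_gt0 : 0 < d by rewrite divr_gt0 ?mulr_gt0 ?exprn_gt0.
have [tau [t1 [tauT taud t1P touch]]] :=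
  touching_line T_gt0 eta_gt0 d_gt0 (fb_ivp_sp_cont sol).
have /andP[tau_gt0 tau_lt] := tauT; have /andP[t1_gt0 t1_le] := t1P.
set v := eta / tau in touch.
have v_ge0 : 0 <= v by rewrite divr_ge0 ?ltW.
have small : 2 * (G * tau) * (G + v * b) <= b ^+ 2.
  have -> : 2 * (G * tau) * (G + v * b) = 2 * G ^+ 2 * tau + b ^+ 2 / 4.
    by rewrite /v /eta; field; rewrite !gt_eqF.
  have : 2 * G ^+ 2 * tau <= 2 * G ^+ 2 * d.
    by rewrite ler_wpM2l // mulr_ge0 // ltW // exprn_gt0.
  have -> : 2 * G ^+ 2 * d = b ^+ 2 / 4 by rewrite /d; field; rewrite gt_eqF.
  have := sqr_ge0 b; lra.
have t1T : 0 < t1 < T by rewrite t1_gt0 (le_lt_trans t1_le).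
have b_lt : b < alpha by rewrite /b; lra.
have [x0 x0P uP] := u_ge_slope sol t1T b_lt.
have vb_ge0 : 0 <= v * b by rewrite mulr_ge0 // ltW.
have bK_gt0 : 0 < b / (G + v * b) by rewrite divr_gt0 //; lra.
pose m := Num.max x0 (sp t1 - b / (G + v * b)).
have m_lt : m < sp t1 by rewrite gt_max x0P ltrBlDr ltrDl.
pose x := (m + sp t1) / 2.
have xp : x < sp t1 by rewrite /x; lra.
have mx : m < x by rewrite /x; lra.
have [x0x bx] : x0 < x /\ sp t1 - b / (G + v * b) < x.
  by move: mx; rewrite gt_max => /andP.
have [|smx ux] := uP x; first by rewrite x0x.
have := u_le_barrier sol (ltW F_gt0) fF tauT v_ge0 b_gt0 touch small (z := (x, t1)).
rewrite /= addrK => /(_ _ (ltW bx)) u_le.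
move: ux; apply/negP; rewrite -leNgt; apply: u_le.
- by rewrite t1_le ltW.
- by rewrite !ltW.
Qed.
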